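(* Let $G$ be a connected undirected graph, $c:E(G)\to\mathbb{R}_{>0}$, $\mathcal{T}\subseteq V(G)$ a terminal set, $r\in\mathcal{T}$ a root terminal, and $L:V(G)\times 2^{\mathcal{T}}\to\mathbb{R}_{\ge 0}$ a valid lower bound. Then the Dijkstra–Steiner algorithm (described in the context) run on this input terminates and returns the edge set of an optimum Steiner tree for $\mathcal{T}$ in $G$.
   Context: A Steiner tree for $X\subseteq V(G)$ is a tree $T$ in $G$ with $X\subseteq V(T)$; $\mathrm{smt}(X)$ denotes the minimum cost $c(E(T))$ of such a tree (so $\mathrm{smt}(\{x\})=0$). A function $L:V(G)\times 2^{\mathcal{T}}\to\mathbb{R}_{\ge0}$ is a valid lower bound (w.r.t. $r$) if $L(r,\{r\})=0$ and $L(v,I)\le L(w,I')+\mathrm{smt}((I\setminus I')\cup\{v,w\})$ for all $v,w\in V(G)$ and all $\{r\}\subseteq I'\subseteq I\subseteq\mathcal{T}$. Dijkstra–Steiner algorithm. Labels are pairs $(v,I)\in V(G)\times 2^{\mathcal{T}\setminus\{r\}}$, each with a value $l(v,I)\in\mathbb{R}_{\ge0}\cup\{\infty\}$ and backtracking data $b(v,I)\subseteq V(G)\times2^{\mathcal{T}\setminus\{r\}}$. Initialization: $l(v,I)=\infty$ for all $(v,I)$; then $l(s,\{s\})=0$ for all $s\in\mathcal{T}\setminus\{r\}$; $l(v,\emptyset)=0$ for all $v$; $b(v,I)=\emptyset$ for all $(v,I)$; $N=\{(s,\{s\}):s\in\mathcal{T}\setminus\{r\}\}$; $P=V(G)\times\{\emptyset\}$.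 While $(r,\mathcal{T}\setminus\{r\})\notin P$: choose $(v,I)\in N$ minimizing $l(v,I)+L(v,\mathcal{T}\setminus I)$; remove it from $N$ and add it to $P$; for every edge $e=\{v,w\}$: if $l(v,I)+c(e)<l(w,I)$ and $(w,I)\notin P$, set $l(w,I):=l(v,I)+c(e)$, $b(w,I):=\{(v,I)\}$, $N:=N\cup\{(w,I)\}$; for every nonempty $J\subseteq(\mathcal{T}\setminus\{r\})\setminus I$ with $(v,J)\in P$: if $l(v,I)+l(v,J)<l(v,I\cup J)$ and $(v,I\cup J)\notin P$, set $l(v,I\cup J):=l(v,I)+l(v,J)$, $b(v,I\cup J):=\{(v,I),(v,J)\}$, $N:=N\cup\{(v,I\cup J)\}$. Finally return $\mathrm{backtrack}(r,\mathcal{T}\setminus\{r\})$, where $\mathrm{backtrack}(v,I)$ returns $\{\{v,w\}\}\cup\mathrm{backtrack}(w,I)$ if $b(v,I)=\{(w,I)\}$, and otherwise returns $\bigcup_{(w,I')\in b(v,I)}\mathrm{backtrack}(w,I')$ (the empty set if $b(v,I)=\emptyset$). *)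

(* Defs.v *)
From HB Require Import structures.
From mathcomp Require Import all_boot all_order all_algebra.
From mathcomp Require Import boolp constructive_ereal reals.
Set Implicit Arguments.
Unset Strict Implicit.
Unset Printing Implicit Defensive.
Import Order.TTheory GRing.Theory Num.Theory.
Local Open Scope ring_scope.

Section Graphs.
Variable V : finType.

(* A simple graph on the vertex set V is given by its set E of edges, each of
   them a two-element set of vertices. *)
Definition simple_graph (E : {set {set V}}) : Prop :=
  forall e, e \in E -> #|e| = 2%N.

Definition adj (E : {set {set V}}) : rel V := fun x y => [set x; y] \in E.

Definition connected_graph (E : {set {set V}}) : Prop :=
  forall x y, connect (adj E) x y.

(* A pair (vertex set, edge set). *)
Definition subgraph := ({set V} * {set {set V}})%type.

Definition is_subgraph (E : {set {set V}}) (S : subgraph) : Prop :=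
  S.2 \subset E /\ forall e, e \in S.2 -> e \subset S.1.

(* In a simple graph, a closed walk with pairwise distinct vertices is a cycle
   iff it has at least three vertices: [:: x; y] uses the edge xy twice. *)
Definition acyclic (F : {set {set V}}) : Prop :=
  forall p : seq V, ucycle (adj F) p -> (size p < 3)%N.

Definition is_tree (S : subgraph) : Prop :=
  [/\ S.1 != set0,
      {in S.1 &, forall x y, connect (adj S.2) x y}
    & acyclic S.2].

Definition steiner_tree (E : {set {set V}}) (X : {set V}) (S : subgraph) : Prop :=
  [/\ is_subgraph E S, is_tree S & X \subset S.1].

Variable R : realType.
Variable c : {set V} -> R.

Definition cost (F : {set {set V}}) : R := \sum_(e in F) c e.

(* The value is +oo when there is no Steiner tree for X, which does not happen
   for nonempty X in a connected graph. *)
Definition smt (E : {set {set V}}) (X : {set V}) : \bar R :=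
  \big[Order.min/+oo%E]_(S : subgraph | `[< steiner_tree E X S >])
    (cost S.2)%:E.

Definition optimum_steiner_tree (E : {set {set V}}) (X : {set V})
    (S : subgraph) : Prop :=
  steiner_tree E X S /\
  forall S', steiner_tree E X S' -> cost S.2 <= cost S'.2.

(* Only the values L v I with I \subset T are relevant. *)
Definition valid_lower_bound (E : {set {set V}}) (T : {set V}) (r : V)
    (L : V -> {set V} -> R) : Prop :=
  [/\ forall v (I : {set V}), I \subset T -> 0 <= L v I,
      L r [set r] = 0
    & forall (v w : V) (I I' : {set V}),
        [set r] \subset I' -> I' \subset I -> I \subset T ->
        ((L v I)%:E <= (L w I')%:E + smt E ((I :\: I') :|: [set v; w]))%E].

End Graphs.

Section DijkstraSteiner.
Variables (R : realType) (V : finType) (E : {set {set V}}) (c : {set V} -> R).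
Variables (T : {set V}) (r : V) (L : V -> {set V} -> R).

(* The labels (v, I) of the algorithm are those with I \subset T :\ r; the
   other ones keep the value +oo and never enter N or P. *)
Definition label := (V * {set V})%type.

Record state := State {
  lval : label -> \bar R;
  bdata : label -> {set label};
  openN : {set label};
  permP : {set label} }.

Definition target : label := (r, T :\ r).

Definition init_state : state :=
  State
    (fun x => if x.2 == set0 then 0%E
              else if (x.1 \in T :\ r) && (x.2 == [set x.1]) then 0%E
              else +oo%E)
    (fun=> set0)
    [set (s, [set s]) | s in T :\ r]
    [set (v, set0) | v : V].

Definition relax (s : state) (x : label) (d : \bar R) (B : {set label}) :
    state :=
  if (d < lval s x)%E && (x \notin permP s) then
    State (fun y => if y == x then d else lval s y)
          (fun y => if y == x then B else bdata s y)
          (x |: openN s) (permP s)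
  else s.

Definition edge_body (v : V) (I : {set V}) (s : state) (w : V) : state :=
  relax s (w, I) (lval s (v, I) + (c [set v; w])%:E)%E [set (v, I)].

Definition merge_body (v : V) (I : {set V}) (s : state) (J : {set V}) : state :=
  if (v, J) \in permP s then
    relax s (v, I :|: J) (lval s (v, I) + lval s (v, J))%E [set (v, I); (v, J)]
  else s.

Definition make_permanent (s : state) (x : label) : state :=
  State (lval s) (bdata s) (openN s :\ x) (x |: permP s).

Definition key (s : state) (x : label) : \bar R :=
  (lval s x + (L x.1 (T :\: x.2))%:E)%E.

(* One iteration of the while loop.  The choice among the minimizers and the
   orders ws and Js in which the two inner loops run are arbitrary. *)
Definition step (s s' : state) : Prop :=
  target \notin permP s /\
  exists (v : V) (I : {set V}) (ws : seq V) (Js : seq {set V}),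
    [/\ (v, I) \in openN s,
        forall y, y \in openN s -> (key s (v, I) <= key s y)%E,
        perm_eq ws (enum [set w | [set v; w] \in E]),
        perm_eq Js
          (enum [set J : {set V} | (J != set0) && (J \subset (T :\ r) :\: I)])
      & s' = foldl (merge_body v I)
               (foldl (edge_body v I) (make_permanent s (v, I)) ws) Js].

Inductive reachable : state -> Prop :=
| reachable_init : reachable init_state
| reachable_step s s' : reachable s -> step s s' -> reachable s'.

(* Big-step semantics of the deterministic recursive procedure backtrack:
   a derivation is a terminating evaluation with result the last argument. *)
Inductive backtracks (b : label -> {set label}) :
    label -> {set {set V}} -> Prop :=
| backtracks_edge v w I F :
    b (v, I) = [set (w, I)] -> backtracks b (w, I) F ->
    backtracks b (v, I) ([set v; w] |: F)
| backtracks_union v I (F : label -> {set {set V}}) :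
    (forall w, b (v, I) <> [set (w, I)]) ->
    (forall x, x \in b (v, I) -> backtracks b x (F x)) ->
    backtracks b (v, I) (\bigcup_(x in b (v, I)) F x).

(* The while loop has no infinite execution, it never has to choose an element
   of an empty N, and when it exits the call of backtrack terminates. *)
Definition dijkstra_steiner_terminates : Prop :=
  [/\ ~ exists run : nat -> state,
          run 0%N = init_state /\ forall n, step (run n) (run n.+1),
      forall s, reachable s -> target \notin permP s -> exists s', step s s'
    & forall s, reachable s -> target \in permP s ->
        exists F, backtracks (bdata s) target F].

Definition dijkstra_steiner_returns (F : {set {set V}}) : Prop :=
  exists s, [/\ reachable s, target \in permP s & backtracks (bdata s) target F].

End DijkstraSteiner.

(* Main.v *)
(* Call d derivable for a label (v, I) if it arises from the terminals by
   moving along edges and merging disjoint labels at a vertex.  Deleting edges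
   one by one shows that the minimum derivable value is smt(I + v), and every
   derivation uses a connected edge set of cost at most d.

   Suppose that all permanent labels have minimum value, and let (v, I) be an
   open label with minimum key.  Any derivation of some d for (v, I) passes
   through an open label (w, J) with l(w, J) + cost F <= d, where F are the edges
   used after (w, J).  As F connects v, w and I \ J, validity of L gives
   L(w, T \ J) <= L(v, T \ I) + cost F, and comparing keys yields l(v, I) <= d.
   So the new permanent label has minimum value too.

   The edges found by backtracking connect T at cost at most l(r, T - r); since
   edge costs are positive, minimality excludes cycles. *)
Require Import Defs.
From HB Require Import structures.
From mathcomp Require Import all_boot all_order all_algebra.
From mathcomp Require Import boolp constructive_ereal reals.
From mathcomp Require Import lra.
Set Implicit Arguments.
Unset Strict Implicit.
Unset Printing Implicit Defensive.
Import Order.TTheory GRing.Theory Num.Theory.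
Local Open Scope ring_scope.

(** * Connectivity after deleting an edge *)

Section EdgeSets.
Variable V : finType.
Implicit Types (F G : {set {set V}}) (v w x y : V).

Lemma adj_sym F : symmetric (adj F).
Proof. by move=> x y; rewrite /adj setUC. Qed.

Lemma connect_adjC F x y : connect (adj F) x y = connect (adj F) y x.
Proof. exact: sym_connect_sym (@adj_sym F) x y. Qed.

Lemma connect_adjS F G x y :
  F \subset G -> connect (adj F) x y -> connect (adj G) x y.
Proof.
move=> sFG; apply: connect_sub => a b ab.
by apply: connect1; apply: (subsetP sFG).
Qed.

Lemma set2_eqP v w x y :
  [set v; w] = [set x; y] -> (v = x /\ w = y) \/ (v = y /\ w = x).
Proof.
move=> eq_vw.
have := set21 v w; have := set22 v w; have := set21 x y; have := set22 x y.
rewrite {1 2}eq_vw -{1 2}eq_vw !in_set2 => /orP hy /orP hx /orP hw /orP hv.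
by case: hx; case: hy; case: hv; case: hw; do 4![move/eqP=> ?]; subst; auto.
Qed.

(** Induction from the far end of the walk: a step along the deleted edge lands on [v] or [w], and
    any other step survives the deletion. *)
Lemma connect_setD1 F v w x :
  connect (adj F) v x ->
  connect (adj (F :\ [set v; w])) v x || connect (adj (F :\ [set v; w])) w x.
Proof.
case/connectP=> p; elim/last_ind: p x => [|p z IHp] x /= pP ->.
  by rewrite connect0.
rewrite last_rcons; move: pP; rewrite rcons_path => /andP[pP pz].
have := IHp _ pP erefl.
have [/eqP/set2_eqP[[_ ->]|[_ ->]] _|ne] := boolP ([set last v p; z] == [set v; w]).
- by rewrite connect0 orbT.
- by rewrite connect0.
have st : connect (adj (F :\ [set v; w])) (last v p) z.
  by apply: connect1; rewrite /adj in_setD1 ne.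
by case/orP=> h; rewrite (connect_trans h st) ?orbT.
Qed.

Lemma connect_setD1_redundant F v w x y :
  connect (adj (F :\ [set v; w])) v w ->
  connect (adj F) x y -> connect (adj (F :\ [set v; w])) x y.
Proof.
move=> cvw; apply: connect_sub => a b ab.
have [/eqP/set2_eqP[[-> ->]|[-> ->]]|ne] := boolP ([set a; b] == [set v; w]).
- exact: cvw.
- by rewrite connect_adjC.
- by apply: connect1; rewrite /adj in_setD1 ne.
Qed.

(** The rest of the cycle is a detour around its first edge. Nonempty [q] matters: on two vertices
    the way back is the deleted edge itself. *)
Lemma ucycle_setD1_connect F v w q :
  (0 < size q)%N -> ucycle (adj F) [:: v, w & q] ->
  connect (adj (F :\ [set v; w])) v w.
Proof.
case: q => [//|z q] _ /andP[] /=; rewrite rcons_path.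
case/and4P=> vw wz zq qv; rewrite !inE !negb_or.
case/andP=> /and3P[nvw nvz nvq] /andP[/andP[nwz nwq] /andP[nzq uq]].
rewrite connect_adjC.
have wz' : adj (F :\ [set v; w]) w z.
  rewrite /adj in_setD1 [_ \in F]wz andbT; apply/eqP=> /set2_eqP[[e _]|[_ e]].
    by rewrite e eqxx in nvw.
  by rewrite e eqxx in nvz.
apply: connect_trans (connect1 wz') _; apply/connectP.
exists (rcons q v); last by rewrite last_rcons.
have zqv : path (adj F) z (rcons q v) by rewrite rcons_path zq.
(* From [z] on, the cycle avoids [w] until it closes at [v], so none of these edges is the deleted
   one. *)
apply: (sub_in_path (P := predC1 w)) zqv.
  move=> a b /= na nb ab; rewrite /adj in_setD1 [_ \in F]ab andbT.
  apply/eqP=> /set2_eqP[[_ e]|[e _]].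
    by move: nb; rewrite inE /= e eqxx.
  by move: na; rewrite inE /= e eqxx.
rewrite /= eq_sym nwz all_rcons /= nvw; apply/allP=> a aq /=.
by apply: contraNneq nwq => <-.
Qed.

Definition component_edges F v : {set {set V}} :=
  [set e in F | [forall x in e, connect (adj F) v x]].

Lemma connect_component_edges F v x :
  connect (adj F) v x -> connect (adj (component_edges F v)) v x.
Proof.
case/connectP=> p; elim/last_ind: p x => [|p z IHp] x /= pP ->.
  exact: connect0.
rewrite last_rcons; move: pP; rewrite rcons_path => /andP[pP pz].
apply: connect_trans (IHp _ pP erefl) (connect1 _).
rewrite /adj inE [_ \in F]pz /=; apply/forall_inP=> a.
have cl : connect (adj F) v (last v p) by apply/connectP; exists p.
rewrite in_set2 => /orP[]/eqP-> //.
exact: connect_trans cl (connect1 pz).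
Qed.

End EdgeSets.

(** * Connected edge sets, their cost, and Steiner trees *)

Section Spanning.
Variables (R : realType) (V : finType) (E : {set {set V}}) (c : {set V} -> R).
Implicit Types (F G : {set {set V}}) (v w x y : V) (X Y : {set V}).

(** A connected subgraph through [v] and [X] whose vertex set is implicit: the vertices reachable
    from [v]. Cycles are allowed, which makes the notion closed under unions. *)
Definition spans F v X : Prop :=
  [/\ F \subset E,
      forall e x, e \in F -> x \in e -> connect (adj F) v x
    & forall x, x \in X -> connect (adj F) v x].

Lemma spans0 v : spans set0 v [set v].
Proof.
split=> [|e x|x]; rewrite ?sub0set ?inE // => /eqP->; exact: connect0.
Qed.

Lemma spansS F v X Y : Y \subset X -> spans F v X -> spans F v Y.
Proof. by move=> sYX [? ? FX]; split=> // x /(subsetP sYX)/FX. Qed.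

Lemma spansU F G v X Y :
  spans F v X -> spans G v Y -> spans (F :|: G) v (X :|: Y).
Proof.
move=> [FE FF FX] [GE GG GY]; split=> [|e x|x]; rewrite ?subUset ?FE //.
- rewrite inE => /orP[eF xe|eG xe].
    exact: connect_adjS (subsetUl _ _) (FF _ _ eF xe).
  exact: connect_adjS (subsetUr _ _) (GG _ _ eG xe).
- rewrite inE => /orP[/FX|/GY].
    exact: connect_adjS (subsetUl _ _).
  exact: connect_adjS (subsetUr _ _).
Qed.

Lemma spans_edge F v w X :
  [set w; v] \in E -> spans F v X -> spans ([set w; v] |: F) w X.
Proof.
move=> wvE [FE FF FX].
have cwv : connect (adj ([set w; v] |: F)) w v.
  by apply: connect1; rewrite /adj setU11.
have up x : connect (adj F) v x -> connect (adj ([set w; v] |: F)) w x.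
  by move=> h; apply: connect_trans cwv (connect_adjS (subsetUr _ _) h).
split=> [|e x|x].
- by rewrite subUset sub1set wvE.
- rewrite in_setU1 => /orP[/eqP->|eF xe]; last exact/up/(FF e).
  by rewrite in_set2 => /orP[]/eqP->.
- by move/FX/up.
Qed.

Lemma spans_setD1 F v X a b :
  connect (adj (F :\ [set a; b])) a b -> spans F v X ->
  spans (F :\ [set a; b]) v X.
Proof.
move=> cab [FE FF FX]; split=> [|e x|x].
- exact: subset_trans (subsetDl _ _) FE.
- by rewrite in_setD1 => /andP[_ eF] xe; apply: connect_setD1_redundant => //; apply: (FF e).
- by move/FX; apply: connect_setD1_redundant.
Qed.

Lemma spans_component F v X :
  F \subset E -> spans (component_edges F v) v (X :&: [set x | connect (adj F) v x]).
Proof.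
move=> FE; split=> [|e x|x].
- by apply: subset_trans FE; apply/subsetP=> e; rewrite inE => /andP[].
- rewrite inE => /andP[_ /forall_inP h] xe.
  exact/connect_component_edges/h.
- by rewrite !inE => /andP[_]; apply: connect_component_edges.
Qed.

Lemma steiner_tree_spans X v S :
  v \in X -> steiner_tree E X S -> spans S.2 v X.
Proof.
move=> vX [[SE SV] [_ Sc _] XS]; have vS := subsetP XS _ vX.
split=> // [e x eS xe|x xX]; apply: Sc => //.
  exact: subsetP (SV _ eS) _ xe.
exact: subsetP XS _ xX.
Qed.

Hypothesis c_gt0 : forall e, e \in E -> 0 < c e.

Lemma cost_ge0 F : F \subset E -> 0 <= cost c F.
Proof. by move=> FE; apply: sumr_ge0 => e eF; apply/ltW/c_gt0/(subsetP FE). Qed.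

Lemma costS F G : G \subset E -> F \subset G -> cost c F <= cost c G.
Proof.
move=> GE FG; rewrite /cost (big_setID F (A := G)) /= (setIidPr FG) lerDl.
by apply: cost_ge0; apply: subset_trans GE; apply: subsetDl.
Qed.

Lemma costU_disjoint F G : [disjoint F & G] ->
  cost c (F :|: G) = cost c F + cost c G.
Proof.
move=> dFG; rewrite /cost -bigU //=.
by apply: eq_bigl => e; rewrite !inE.
Qed.

Lemma costU F G : F \subset E -> G \subset E ->
  cost c (F :|: G) <= cost c F + cost c G.
Proof.
move=> FE GE; rewrite -(setIidPl GE).
have -> : F :|: (G :&: E) = F :|: (G :\: F).
  by apply/setP=> e; rewrite !inE; case eG: (e \in G);
    rewrite ?(subsetP GE _ eG) ?andbT ?andbF //; case: (e \in F).
rewrite costU_disjoint; last by rewrite -setI_eq0 setDE setICA setICr setI0.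
by rewrite lerD2l (setIidPl GE); apply: costS => //; apply: subsetDl.
Qed.

Lemma cost1 e : cost c [set e] = c e.
Proof. by rewrite /cost big_set1. Qed.

Lemma cost_setD1 F e : e \in F -> cost c F = c e + cost c (F :\ e).
Proof. by move=> eF; rewrite /cost (big_setD1 e). Qed.

(** An edge on a cycle could be deleted without losing the spanning property, and its cost is
    positive. *)
Lemma min_spans_tree F v X :
  spans F v X -> (forall G, spans G v X -> cost c F <= cost c G) ->
  steiner_tree E (v |: X) ([set x | connect (adj F) v x], F).
Proof.
move=> spF minF; have [FE FF FX] := spF; split=> /=.
- by split=> //= e eF; apply/subsetP=> x xe; rewrite inE (FF e).
- split=> /=.
  + by apply/set0Pn; exists v; rewrite inE connect0.
  + move=> x y; rewrite !inE => vx vy.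
    by apply: connect_trans vy; rewrite connect_adjC.
  + move=> [|a [|b q]] // cyc; rewrite !ltnS leqn0.
    case: posnP => // q_gt0.
    have abF : [set a; b] \in F by case/andP: cyc => /=/andP[].
    have := minF _ (spans_setD1 (ucycle_setD1_connect q_gt0 cyc) spF).
    rewrite (cost_setD1 abF) -subr_ge0 opprD addrCA subrr addr0 oppr_ge0.
    by rewrite leNgt c_gt0 // (subsetP FE).
- by apply/subsetP=> x; rewrite !inE => /orP[/eqP->|/FX//]; rewrite connect0.
Qed.

(** A cheapest set spanning [X] from [v] is a tree, hence a Steiner tree for [Y] that costs no more
    than [F]. *)
Lemma smt_le_cost F v X Y :
  spans F v X -> Y \subset v |: X -> (smt c E Y <= (cost c F)%:E)%E.
Proof.
move=> spF sY.
case: (@arg_minP _ _ _ F (fun G => `[< spans G v X >]) (cost c)).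
  exact/asboolP.
move=> G /asboolP spG minG.
apply: (bigmin_inf ([set x | connect (adj G) v x], G)); last first.
  by rewrite lee_fin; apply: minG; apply/asboolP.
apply/asboolP; have [? ? sX] : steiner_tree E (v |: X) ([set x | connect (adj G) v x], G).
  by apply: min_spans_tree => // H spH; apply: minG; apply/asboolP.
by split=> //; apply: subset_trans sX.
Qed.

Lemma min_spans_optimum F v X :
  spans F v X -> (forall G, spans G v X -> cost c F <= cost c G) ->
  exists S : subgraph V, optimum_steiner_tree c E (v |: X) S /\ S.2 = F.
Proof.
move=> spF minF; exists ([set x | connect (adj F) v x], F).
split=> //; split=> [|S /(steiner_tree_spans (setU11 v X)) spS].
  exact: min_spans_tree.
by apply: minF; apply: spansS spS; apply: subsetUr.
Qed.

End Spanning.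

(** * Derivable values against costs of spanning sets *)

Section DreyfusWagner.
Variables (R : realType) (V : finType) (E : {set {set V}}) (c : {set V} -> R).
Variables (T : {set V}) (r : V).
Hypothesis simpleE : simple_graph E.
Hypothesis c_gt0 : forall e, e \in E -> 0 < c e.
Implicit Types (F G : {set {set V}}) (v w x y : V) (I J : {set V}) (d : R).

(* The values that the label (v, I) can take when the relaxations of the
   algorithm are performed in an arbitrary order. *)
Inductive derivable : V -> {set V} -> R -> Prop :=
| derivable_terminal t : t \in T :\ r -> derivable t [set t] 0
| derivable_edge v w I d :
    [set v; w] \in E -> derivable v I d -> derivable w I (d + c [set v; w])
| derivable_merge v I J d d' :
    [disjoint I & J] -> derivable v I d -> derivable v J d' ->
    derivable v (I :|: J) (d + d').

Lemma derivable_neq0 v I d : derivable v I d -> I != set0.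
Proof.
elim=> // [t _|{}v {I}I J _ _ _ _ In0 _ _].
  by apply/set0Pn; exists t; rewrite set11.
by rewrite setU_eq0 negb_and In0.
Qed.

(** The edges of a derivation are collected along it. Overlaps in merges and repeated edges only
    lower the cost, hence the inequality. *)
Lemma derivable_spans v I d :
  derivable v I d -> exists2 F, spans E F v I & cost c F <= d.
Proof.
elim=> [t _|{}v w {}I {}d vwE _ [F spF Fd]|{}v {}I J {}d d' _ _ [F spF Fd] _ [G spG Gd]].
- by exists set0; [exact: spans0|rewrite /cost big_set0].
- rewrite setUC in vwE; exists ([set w; v] |: F); first exact: spans_edge.
  have [FE _ _] := spF.
  apply: le_trans (costU c_gt0 _ FE) _; first by rewrite sub1set.
  by rewrite cost1 addrC [[set v; w]]setUC lerD.
- exists (F :|: G); first exact: spansU.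
  have [FE _ _] := spF; have [GE _ _] := spG.
  exact: le_trans (costU c_gt0 FE GE) (lerD Fd Gd).
Qed.

(* Delete an edge vw of F at v.  Either v still spans F, or F falls apart into
   an edge set at v and one at w, from which a label at v is obtained by moving
   the one at w across vw and merging. *)
Lemma spans_derivable F v I :
  spans E F v I -> I != set0 -> I \subset T :\ r ->
  exists2 d, derivable v I d & d <= cost c F.
Proof.
move: {2}#|F|.+1 (ltnSn #|F|) => n; elim: n F v I => // n IHn F v I ltFn spF In0 IT.
have [FE FF FI] := spF.
have [eqI|neqI] := eqVneq I [set v].
  exists 0; last exact: (cost_ge0 c_gt0 FE).
  by rewrite eqI; apply: derivable_terminal; rewrite -sub1set -eqI.
(* Some [x] in [I] differs from [v]; the first edge of a walk from [v] to [x] will do. *)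
have [w vwF] : exists w, [set v; w] \in F.
  have [x xI xv] : exists2 x, x \in I & x != v.
    apply/exists_inP; apply: contraNT neqI => /exists_inPn allv.
    rewrite eqEsubset; apply/andP; split.
      by apply/subsetP=> x xI; rewrite inE; apply/negPn/allv.
    have [x xI] := set0Pn _ In0; rewrite sub1set.
    by have /negPn/eqP <- := allv _ xI.
  case/connectP: (FI _ xI) => [[|w p] /=]; first by move=> _ e; rewrite e eqxx in xv.
  by case/andP=> vw _ _; exists w.
have vwE := subsetP FE _ vwF.
set e := [set v; w] in vwF vwE *; set F' := F :\ e.
have costF : cost c F = c e + cost c F' by exact: cost_setD1.
have sF'F : F' \subset F by exact: subsetDl.
have F'E := subset_trans sF'F FE.
have cardF' : (#|F'| < n)%N.
  by apply: leq_trans (proper_card (properD1 vwF)) _; rewrite -ltnS.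
have [cvw|ncvw] := boolP (connect (adj F') v w).
  have [d dd dF'] := IHn _ _ _ cardF' (spans_setD1 cvw spF) In0 IT.
  by exists d => //; apply: le_trans dF' (costS c_gt0 FE sF'F).
pose C x := [set y | connect (adj F') x y].
have sComp x : component_edges F' x \subset F'.
  by apply/subsetP=> f; rewrite inE => /andP[].
have ltComp x : (#|component_edges F' x| < n)%N.
  exact: leq_ltn_trans (subset_leq_card (sComp x)) cardF'.
have spComp x := spans_component x I F'E.
have subT x : I :&: C x \subset T :\ r by apply: subset_trans IT; apply: subsetIl.
have disj x : x \in C v -> x \in C w -> False.
  rewrite !inE => vx wx; case/negP: ncvw.
  by apply: connect_trans vx _; rewrite connect_adjC.
have eqI : I = (I :&: C w) :|: (I :&: C v).
  rewrite -setIUr; apply/esym/setIidPl/subsetP=> x xI; rewrite !inE orbC.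
  exact/connect_setD1/FI.
(* A common edge has an endpoint, as [E] is simple, and that endpoint would connect [v] with [w]. *)
have dComp : [disjoint component_edges F' w & component_edges F' v].
  rewrite -setI_eq0; apply/eqP/setP=> f; rewrite !inE; apply/negP.
  case/andP=> /andP[/andP[_ fF] /forall_inP fw] /andP[_ /forall_inP fv].
  have /set0Pn[x xf] : f != set0 by rewrite -card_gt0 simpleE ?(subsetP FE).
  by apply: (disj x); rewrite inE ?fv ?fw.
have costC : cost c (component_edges F' w) + cost c (component_edges F' v) <= cost c F'.
  by rewrite -costU_disjoint // (costS c_gt0) // subUset !sComp.
have costC_ge0 x : 0 <= cost c (component_edges F' x).
  by apply: (cost_ge0 c_gt0); apply: subset_trans F'E.
have wv : [set w; v] = e by rewrite setUC.
have := costC_ge0 v; have := costC_ge0 w; have ce := c_gt0 vwE.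
(* Derivable labels have nonempty sets, so a side that meets [I] in nothing is discarded and the
   other side alone yields the value. *)
have [w0|wn0] := eqVneq (I :&: C w) set0.
  rewrite w0 set0U in eqI.
  have spv := spComp v; rewrite -/(C v) -eqI in spv.
  have [d dd dle] := IHn _ v I (ltComp v) spv In0 IT.
  by exists d => //; lra.
have [d dd dle] := IHn _ _ _ (ltComp w) (spComp w) wn0 (subT w).
have dv : derivable v (I :&: C w) (d + c e).
  by rewrite -wv; apply: derivable_edge; rewrite ?wv.
have [v0|vn0] := eqVneq (I :&: C v) set0.
  by exists (d + c e); [rewrite eqI v0 setU0|lra].
have [d' dd' dle'] := IHn _ _ _ (ltComp v) (spComp v) vn0 (subT v).
exists (d + c e + d'); last by lra.
rewrite eqI; apply: derivable_merge => //.
rewrite -setI_eq0; apply/eqP/setP=> x; rewrite !(in_setI, in_set0).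
apply/negP=> /andP[/andP[_ xw] /andP[_ xv]]; exact: disj xv xw.
Qed.

End DreyfusWagner.

(** * Certificates for backtracking and the loop invariant *)

Section Algorithm.
Variables (R : realType) (V : finType) (E : {set {set V}}) (c : {set V} -> R).
Variables (T : {set V}) (r : V) (L : V -> {set V} -> R).
Hypothesis simpleE : simple_graph E.
Hypothesis connE : connected_graph E.
Hypothesis c_gt0 : forall e, e \in E -> 0 < c e.
Hypothesis rT : r \in T.
Hypothesis validL : valid_lower_bound c E T r L.

Implicit Types (F G : {set {set V}}) (v w : V) (I J : {set V}) (d : R).
Implicit Types (b : label V -> {set label V}) (P : {set label V}).
Implicit Types (s : state R V).

(* The backtracking data only leave a label for permanent ones, whose data
   never change again; hence the restriction to P. *)
Inductive certified b P : V -> {set V} -> R -> Prop :=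
| certified_terminal t :
    t \in T :\ r -> b (t, [set t]) = set0 -> certified b P t [set t] 0
| certified_edge v w I d :
    [set v; w] \in E -> b (w, I) = [set (v, I)] -> (v, I) \in P ->
    certified b P v I d -> certified b P w I (d + c [set v; w])
| certified_merge v I J d d' :
    [disjoint I & J] -> b (v, I :|: J) = [set (v, I); (v, J)] ->
    (v, I) \in P -> (v, J) \in P ->
    certified b P v I d -> certified b P v J d' ->
    certified b P v (I :|: J) (d + d').

Lemma certified_derivable b P v I d :
  certified b P v I d -> derivable E c T r v I d.
Proof.
elim=> [t tT _|{}v w {}I {}d vwE _ _ _ ih|{}v {}I J {}d d' dIJ _ _ _ _ ih _ ih'].
- exact: derivable_terminal.
- exact: derivable_edge.
- exact: derivable_merge.
Qed.

Lemma certified_sub b P v I d : certified b P v I d -> I \subset T :\ r.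
Proof.
by elim=> // [t tT _|{}v {}I J {}d d' _ _ _ _ _ IT _ JT];
  rewrite ?sub1set // subUset IT.
Qed.

(** Below its top label a certificate reads only data of labels in [P], so data elsewhere may be
    overwritten. *)
Lemma certified_eq b b' P P' v I d :
  {in P, b' =1 b} -> P \subset P' -> b' (v, I) = b (v, I) ->
  certified b P v I d -> certified b' P' v I d.
Proof.
move=> eqb sPP' + ct.
elim: ct => [t tT bt|{}v w {}I {}d vwE bw vP _ ih|{}v {}I J {}d d' dIJ bv vI vJ _ ih _ ih'] ebt.
- by apply: certified_terminal; rewrite // ebt.
- apply: certified_edge; rewrite ?ebt ?(subsetP sPP') //.
  exact/ih/eqb.
- apply: certified_merge; rewrite ?ebt ?(subsetP sPP') //.
    exact/ih/eqb.
  exact/ih'/eqb.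
Qed.

(** Disjoint nonempty sets differ, so backtracking cannot mistake a merge for an edge step. *)
Lemma merge_neq_singleton v I J (z : label V) :
  [disjoint I & J] -> I != set0 -> [set (v, I); (v, J)] <> [set z].
Proof.
move=> dIJ In0 e; have := set21 (v, I) (v, J); have := set22 (v, I) (v, J).
rewrite e !inE => /eqP<- /eqP[eIJ].
by case/negP: In0; move: dIJ; rewrite eIJ -setI_eq0 setIid.
Qed.

Lemma certified_backtracks b P v I d :
  certified b P v I d -> exists F, backtracks b (v, I) F.
Proof.
elim=> [t tT bt|{}v w {}I {}d vwE bw vP _ [F hF]|{}v {}I J {}d d' dIJ bv vI vJ ct [F hF] _ [G hG]].
- eexists; apply: (@backtracks_union _ b t [set t] (fun=> set0)) => [w|x].
    rewrite bt => /setP/(_ (w, [set t])).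
    by rewrite !inE eqxx.
  by rewrite bt inE.
- by exists ([set w; v] |: F); apply: backtracks_edge.
- have In0 := derivable_neq0 (certified_derivable ct).
  (* The union rule wants a result for every label; only the values at the two merged labels
     matter. *)
  pose H (x : label V) := if x == (v, I) then F else G.
  exists (\bigcup_(x in b (v, I :|: J)) H x); apply: backtracks_union.
    by move=> w; rewrite bv; apply: merge_neq_singleton.
  move=> x; rewrite bv in_set2 /H; case: eqP => [->//|_ /= /eqP->//].
Qed.

(** Inversion of the evaluation, with projections of [x] so that the label need not be a variable
    pair. *)
Lemma backtracksP b (x : label V) F : backtracks b x F ->
  (exists w G, [/\ b x = [set (w, x.2)], backtracks b (w, x.2) G
                 & F = [set x.1; w] |: G]) \/
  (forall w, b x <> [set (w, x.2)]) /\
  exists2 G : label V -> {set {set V}},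
    forall y, y \in b x -> backtracks b y (G y) & F = \bigcup_(y in b x) G y.
Proof.
case=> [v w I G bv hG|v I G bv hG].
  by left; exists w, G.
by right; split=> //; exists G.
Qed.

Lemma backtracks_spans b P v I d F :
  certified b P v I d -> backtracks b (v, I) F ->
  spans E F v I /\ cost c F <= d.
Proof.
move=> ct; elim: ct F => [t tT bt|{}v w {}I {}d vwE bw vP _ ih|{}v {}I J {}d d' dIJ bv vI vJ ct ih _ ih'] F.
- case/backtracksP=> /= [[w [G []]]|[_ [G _ ->]]]; rewrite bt.
    by move=> /setP/(_ (w, [set t])); rewrite !inE eqxx.
  by rewrite big_set0 /cost big_set0; split=> //; apply: spans0.
- case/backtracksP=> /= [[x [G []]]|[/(_ v)//]]; rewrite bw.
  case/set1_inj=> <- /ih[spG leG] ->; rewrite setUC in vwE.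
  split; first exact: spans_edge.
  have [GE _ _] := spG.
  apply: le_trans (costU c_gt0 _ GE) _; first by rewrite sub1set.
  by rewrite cost1 addrC [[set v; w]]setUC lerD.
- have In0 := derivable_neq0 (certified_derivable ct).
  case/backtracksP=> /= [[x [G []]]|[_ [G]]]; rewrite bv.
    by move/merge_neq_singleton; case.
  move=> hG ->; have [spF leF] := ih _ (hG _ (set21 _ _)).
  have [spG leG] := ih' _ (hG _ (set22 _ _)).
  have -> : \bigcup_(y in [set (v, I); (v, J)]) G y = G (v, I) :|: G (v, J).
    by rewrite bigcup_setU !big_set1.
  split; first exact: spansU.
  have [FE _ _] := spF; have [GE _ _] := spG.
  exact: le_trans (costU c_gt0 FE GE) (lerD leF leG).
Qed.

(* Distinct from [seq.permP]. *)
Local Notation permP := Defs.permP.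

(** Certified values are derivable, so [inv_certified] and [inv_optimal] together say that a
    permanent label with nonempty set holds its least derivable value. *)
Record invariant s : Prop := Invariant {
  inv_infty : forall x, x \notin openN s :|: permP s -> lval s x = +oo%E;
  inv_certified : forall v I, (v, I) \in openN s :|: permP s -> I != set0 ->
    exists2 d, lval s (v, I) = d%:E & certified (bdata s) (permP s) v I d;
  inv_open : forall x, x \in openN s -> x.2 != set0 /\ x \notin permP s;
  inv_empty : forall v,
    (v, set0) \in permP s /\ bdata s (v, set0) = set0;
  inv_terminal : forall t, t \in T :\ r -> (lval s (t, [set t]) <= 0)%E;
  inv_optimal : forall v I d, (v, I) \in permP s ->
    derivable E c T r v I d -> (lval s (v, I) <= d%:E)%E }.

(** * Relaxation inequalities and optimality of the chosen label *)

Definition edge_relaxed s v I w : Prop :=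
  (lval s (w, I) <= lval s (v, I) + (c [set v; w])%:E)%E.

Definition merge_relaxed s v I J : Prop :=
  (lval s (v, I :|: J) <= lval s (v, I) + lval s (v, J))%E.

(** Kept apart from [invariant] because it may fail inside an iteration, until both inner loops have
    treated the new permanent label. *)
Definition relaxed s : Prop :=
  (forall v w I, (v, I) \in permP s -> I != set0 -> [set v; w] \in E ->
     edge_relaxed s v I w) /\
  (forall v I J, [disjoint I & J] -> I != set0 -> J != set0 ->
     (v, I) \in permP s -> (v, J) \in permP s -> merge_relaxed s v I J).

(** How the inner loops change a state. A relaxation inequality survives: its right side involves
    permanent labels only, and its left side can only drop. *)
Definition extends s s' : Prop :=
  [/\ permP s' = permP s, forall x, (lval s' x <= lval s x)%E
    & {in permP s, lval s' =1 lval s}].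

Lemma extends_trans s1 s2 s3 : extends s1 s2 -> extends s2 s3 -> extends s1 s3.
Proof.
move=> [P12 le12 eq12] [P23 le23 eq23]; split=> [|x|x xP].
- by rewrite P23.
- exact: le_trans (le23 x) (le12 x).
- by rewrite eq23 ?P12 // eq12.
Qed.

Lemma edge_relaxed_extends s s' v I w :
  (v, I) \in permP s -> extends s s' -> edge_relaxed s v I w ->
  edge_relaxed s' v I w.
Proof.
move=> vP [_ le_s' eq_s']; rewrite /edge_relaxed (eq_s' _ vP).
exact: le_trans (le_s' _).
Qed.

Lemma merge_relaxed_extends s s' v I J :
  (v, I) \in permP s -> (v, J) \in permP s -> extends s s' ->
  merge_relaxed s v I J -> merge_relaxed s' v I J.
Proof.
move=> vI vJ [_ le_s' eq_s']; rewrite /merge_relaxed (eq_s' _ vI) (eq_s' _ vJ).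
exact: le_trans (le_s' _).
Qed.

(** The certificate is required for every [b] agreeing with the old data on permanent labels, since
    the updated data function is such a [b]. *)
Lemma relax_invariant s w I d B :
  invariant s -> derivable E c T r w I d ->
  (forall b, {in permP s, b =1 bdata s} -> b (w, I) = B ->
     certified b (permP s) w I d) ->
  let s' := relax s (w, I) d%:E B in
  [/\ invariant s', extends s s' & (lval s' (w, I) <= d%:E)%E].
Proof.
move=> inv der cert; rewrite /relax; have [lt_d /=|le_d /=] := ltP; last first.
  by split.
(* A permanent label is left alone; its value is optimal, so it is at most the derivable [d]
   anyway. *)
have [wP|wP] := boolP ((w, I) \in permP s) => /=.
  by split=> //; apply: inv_optimal.
have neqP x : x \in permP s -> x == (w, I) = false.
  by move=> xP; apply/negP=> /eqP ex; rewrite -ex xP in wP.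
split; last by rewrite eqxx.
- split=> /=.
  + move=> x; rewrite -setUA in_setU1 negb_or => /andP[/negPf-> xNP].
    exact: inv_infty.
  + move=> v J; rewrite -setUA in_setU1; case: eqP => [[-> ->] _ _|/eqP/negPf nvJ /= vNP Jn0].
      exists d => //; apply: cert => [x xP|]; last by rewrite eqxx.
      by rewrite neqP.
    have [d' ld' ct'] := inv_certified inv vNP Jn0.
    exists d' => //.
    apply: certified_eq ct' => // [x xP|]; first by rewrite neqP.
    by rewrite nvJ.
  + move=> x; rewrite in_setU1 => /orP[/eqP->|]; last exact: inv_open.
    by rewrite (derivable_neq0 der).
  + by move=> v; have [vP bv] := inv_empty inv v; rewrite neqP.
  + move=> t tT; case: eqP => [e|_]; last exact: inv_terminal.
    rewrite -e in lt_d.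
    exact: le_trans (ltW lt_d) (inv_terminal inv tT).
  + by move=> v J d' vP; rewrite neqP //; apply: inv_optimal.
- split=> //= x; first by case: eqP => [->|//]; apply: ltW.
  by move=> xP; rewrite neqP.
Qed.

(* In the derivation of d, (w, J) is a label that is not permanent but derived
   from permanent ones only; F consists of the edges used outside of the
   derivation of (w, J). *)
Lemma frontier s v I d :
  invariant s -> relaxed s -> derivable E c T r v I d ->
  (v, I) \in permP s \/
  exists w J F, [/\ (w, J) \in openN s, J \subset I,
    spans E F v (w |: (I :\: J)) & (lval s (w, J) + (cost c F)%:E <= d%:E)%E].
Proof.
move=> inv [edgeR mergeR].
(* A label of finite value is open or permanent; if open, it is its own frontier, with no edges used
   after it. *)
have finish w J x : (lval s (w, J) <= x%:E)%E ->
  (w, J) \in permP s \/ exists w' J' F, [/\ (w', J') \in openN s, J' \subset J,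
    spans E F w (w' |: (J :\: J')) & (lval s (w', J') + (cost c F)%:E <= x%:E)%E].
  move=> le_x; have [|nP] := boolP ((w, J) \in permP s); [by left|right].
  exists w, J, set0; split=> //.
  + apply: contraLR le_x => nN; rewrite inv_infty ?leye_eq //.
    by rewrite in_setU negb_or nN.
  + by rewrite setDv setU0; apply: spans0.
  + by rewrite /cost big_set0 adde0.
elim=> [t tT|{}v w {}I {}d vwE der ih|{}v {}I J {}d d' dIJ der ih der' ih'].
- exact/finish/inv_terminal.
- have In0 := derivable_neq0 der.
  case: ih => [vP|[x [K [F [xN KI spF leF]]]]].
    apply: finish; apply: le_trans (edgeR _ _ _ vP In0 vwE) _.
    by rewrite EFinD leeD2r // inv_optimal.
  right; exists x, K, ([set w; v] |: F); have wvE := vwE; rewrite setUC in wvE.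
  split=> //; first exact: spans_edge.
  have [FE _ _] := spF.
  have le_c : cost c ([set w; v] |: F) <= cost c F + c [set v; w].
    apply: le_trans (costU c_gt0 _ FE) _; first by rewrite sub1set.
    by rewrite cost1 addrC [[set v; w]]setUC.
  rewrite -lee_fin EFinD in le_c.
  apply: le_trans (leeD2l _ le_c) _.
  by rewrite addeA EFinD leeD2r.
- have In0 := derivable_neq0 der; have Jn0 := derivable_neq0 der'.
  (* With a frontier label in one part of a merge, the whole derivation of the other part counts as
     used after it, so its edges [G] join [F]. *)
  have aux I1 J1 d1 d2 : derivable E c T r v J1 d2 ->
      (exists w K F, [/\ (w, K) \in openN s, K \subset I1,
        spans E F v (w |: (I1 :\: K))
        & (lval s (w, K) + (cost c F)%:E <= d1%:E)%E]) ->
      exists w K F, [/\ (w, K) \in openN s, K \subset I1 :|: J1,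
        spans E F v (w |: ((I1 :|: J1) :\: K))
        & (lval s (w, K) + (cost c F)%:E <= (d1 + d2)%:E)%E].
    case/(derivable_spans c_gt0)=> G spG leG [x [K [F [xN KI spF leF]]]].
    exists x, K, (F :|: G); split=> //.
    + exact: subset_trans KI (subsetUl _ _).
    + apply: spansS (spansU spF spG); rewrite -setUA setUS // setDUl setUS //.
      exact: subsetDl.
    + have [FE _ _] := spF; have [GE _ _] := spG.
      have le_c := costU c_gt0 FE GE; rewrite -lee_fin EFinD in le_c.
      apply: le_trans (leeD2l _ le_c) _.
      by rewrite addeA EFinD leeD // lee_fin.
  case: ih => [vI|ih]; last by right; apply: aux.
  case: ih' => [vJ|ih']; last by right; rewrite setUC addrC; apply: aux.
  apply: finish; apply: le_trans (mergeR _ _ _ dIJ In0 Jn0 vI vJ) _.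
  by rewrite EFinD leeD // inv_optimal.
Qed.

Lemma min_key_optimal s v I d :
  invariant s -> relaxed s -> (v, I) \in openN s ->
  (forall y, y \in openN s -> (key T L s (v, I) <= key T L s y)%E) ->
  derivable E c T r v I d -> (lval s (v, I) <= d%:E)%E.
Proof.
move=> inv rel vN minv der.
case: (frontier inv rel der) => [vP|[w [J [F [wN JI spF leF]]]]].
  exact: inv_optimal der.
have [In0 _] := inv_open inv vN.
have [x lx /certified_sub IT] : exists2 d, lval s (v, I) = d%:E &
    certified (bdata s) (permP s) v I d.
  by apply: inv_certified => //; rewrite inE vN.
have rI : r \notin I by apply/negP=> /(subsetP IT); rewrite !inE eqxx.
have [Jn0 _] := inv_open inv wN.
have [y ly _] : exists2 d, lval s (w, J) = d%:E &
    certified (bdata s) (permP s) w J d.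
  by apply: inv_certified => //; rewrite inE wN.
(* Validity is applied to complements: [r] is not in [I], and [J \subset I] reverses to the required
   inclusion. *)
have [_ _ /(_ w v (T :\: J) (T :\: I))] := validL.
rewrite sub1set !inE rT rI setDS // subsetDl => /(_ isT isT isT) leL.
have le_smt : (smt c E ((T :\: J) :\: (T :\: I) :|: [set w; v]) <= (cost c F)%:E)%E.
  apply: (smt_le_cost c_gt0 spF); apply/subsetP=> z; rewrite !inE.
  case: (z \in T); case: (z \in I); case: (z \in J);
    by rewrite ?andbF ?orbF ?orbT //= => /orP[]->; rewrite ?orbT.
(* The chain is l(v, I) + L(v, T \ I) <= l(w, J) + L(w, T \ J) <= l(w, J) + cost F + L(v, T \ I) <=
   d + L(v, T \ I); all terms are finite, so L cancels. *)
have := le_trans leL (leeD2l _ le_smt); have := minv _ wN; move: leF.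
by rewrite /key /= lx ly -!EFinD !lee_fin; lra.
Qed.

(** * Preservation of the invariant by an iteration, and the initial state *)

Lemma make_permanent_invariant s v I :
  invariant s -> (v, I) \in openN s ->
  (forall d, derivable E c T r v I d -> (lval s (v, I) <= d%:E)%E) ->
  invariant (make_permanent s (v, I)).
Proof.
move=> inv vN optv.
have eqNP : openN s :\ (v, I) :|: ((v, I) |: permP s) = openN s :|: permP s.
  by rewrite setUA [_ :|: [set _]]setUC setD1K.
split=> /=.
- by move=> x; rewrite eqNP; apply: inv_infty.
- move=> w J; rewrite eqNP => wNP Jn0.
  have [d ld ct] := inv_certified inv wNP Jn0; exists d => //.
  by apply: certified_eq ct => //; apply: subsetUr.
- move=> x; rewrite in_setD1 in_setU1 => /andP[/negPf-> xN].
  exact: inv_open.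
- by move=> w; have [wP bw] := inv_empty inv w; rewrite in_setU1 wP orbT.
- exact: inv_terminal.
- move=> w J d; rewrite in_setU1 => /orP[/eqP[-> ->]|wP]; first exact: optv.
  exact: inv_optimal.
Qed.

Lemma edge_body_invariant s v I w :
  invariant s -> (v, I) \in permP s -> I != set0 -> [set v; w] \in E ->
  let s' := edge_body c v I s w in
  [/\ invariant s', extends s s' & edge_relaxed s' v I w].
Proof.
move=> inv vP In0 vwE.
have [|d ld ct] := inv_certified inv (v := v) (I := I) _ In0.
  by rewrite inE vP orbT.
rewrite /edge_body ld -EFinD /=.
have [||inv' ext' le'] := @relax_invariant s w I (d + c [set v; w]) [set (v, I)] inv.
- exact/derivable_edge/certified_derivable/ct.
- move=> b eqb bw; apply: certified_edge => //.
  by apply: certified_eq ct => //; apply: eqb.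
- split=> //; have [_ _ eq'] := ext'.
  by rewrite /edge_relaxed (eq' _ vP) ld -EFinD.
Qed.

Lemma merge_body_invariant s v I J :
  invariant s -> (v, I) \in permP s -> I != set0 -> J != set0 ->
  [disjoint I & J] ->
  let s' := merge_body v I s J in
  [/\ invariant s', extends s s'
    & (v, J) \in permP s' -> merge_relaxed s' v I J].
Proof.
move=> inv vI In0 Jn0 dIJ; rewrite /merge_body.
case: ifPn => [vJ|nvJ]; last by split=> //; rewrite (negPf nvJ).
have [|d ld ct] := inv_certified inv (v := v) (I := I) _ In0.
  by rewrite inE vI orbT.
have [|d' ld' ct'] := inv_certified inv (v := v) (I := J) _ Jn0.
  by rewrite inE vJ orbT.
rewrite ld ld' -EFinD /=.
have [||inv' ext' le'] :=
  @relax_invariant s v (I :|: J) (d + d') [set (v, I); (v, J)] inv.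
- by apply: derivable_merge => //; apply: certified_derivable; eassumption.
- move=> b eqb bw; apply: certified_merge => //.
    by apply: certified_eq ct => //; apply: eqb.
  by apply: certified_eq ct' => //; apply: eqb.
- split=> // _; have [_ _ eq'] := ext'.
  by rewrite /merge_relaxed (eq' _ vI) (eq' _ vJ) ld ld' -EFinD.
Qed.

(** Common to both inner loops: each pass establishes [Q] for its own element, and later passes
    preserve it. *)
Lemma foldl_extends (A : eqType) (f : state R V -> A -> state R V)
    (K : state R V -> Prop) (Q : A -> state R V -> Prop) (ok : pred A) :
  (forall s a, ok a -> K s -> [/\ K (f s a), extends s (f s a) & Q a (f s a)]) ->
  (forall s s' a, K s -> extends s s' -> Q a s -> Q a s') ->
  forall al s, all ok al -> K s ->
  let s' := foldl f s al in
  [/\ K s', extends s s' & forall a, a \in al -> Q a s'].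
Proof.
move=> stepf monoQ; elim=> [|a al IHal] s /=; first by split.
case/andP=> oka okal Ks; have [Kfs ext Qa] := stepf s a oka Ks.
have [Ks' ext' Qal] := IHal _ okal Kfs; split=> //.
  exact: extends_trans ext'.
move=> a'; rewrite inE => /orP[/eqP->|]; last exact: Qal.
exact: monoQ Qa.
Qed.

Lemma step_invariant s s' :
  invariant s -> relaxed s -> step E c T r L s s' ->
  [/\ invariant s', relaxed s'
    & exists2 x, x \notin permP s & permP s' = x |: permP s].
Proof.
move=> inv rel [_ [v [I [ws [Js [vN minv perm_ws perm_Js ->]]]]]].
have [/= In0 nvP] := inv_open inv vN.
set s0 := make_permanent s (v, I).
have inv0 : invariant s0.
  by apply: make_permanent_invariant => // d; apply: min_key_optimal.
have vP0 : (v, I) \in permP s0 by rewrite setU11.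
pose K s := invariant s /\ (v, I) \in permP s.
have [||||[inv1 vP1] ext1 edge1] :=
  @foldl_extends _ (edge_body c v I) K (fun w s => edge_relaxed s v I w)
    (fun w => [set v; w] \in E) _ _ ws s0.
- move=> s2 w vwE [inv2 vP2].
  have [inv3 ext3 ?] := edge_body_invariant inv2 vP2 In0 vwE.
  by split=> //; split=> //; case: ext3 => ->.
- by move=> s2 s3 w [_ vP2]; apply: edge_relaxed_extends.
- by apply/allP=> w; rewrite (perm_mem perm_ws) mem_enum inE.
- by [].
set s1 := foldl _ s0 ws in inv1 vP1 ext1 edge1 *.
have [||||[inv2 vP2] ext2 merge2] :=
  @foldl_extends _ (merge_body v I) K
    (fun J s => (v, J) \in permP s -> merge_relaxed s v I J)
    (fun J => (J != set0) && [disjoint I & J]) _ _ Js s1.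
- move=> s2 J /andP[Jn0 dIJ] [inv2 vP2].
  have [inv3 ext3 ?] := merge_body_invariant inv2 vP2 In0 Jn0 dIJ.
  by split=> //; split=> //; case: ext3 => ->.
- move=> s2 s3 J [_ vP2] ext mrg vJ3; have vJ2 : (v, J) \in permP s2.
    by case: ext vJ3 => ->.
  exact: merge_relaxed_extends (mrg vJ2).
- apply/allP=> J; rewrite (perm_mem perm_Js) mem_enum inE subsetD.
  by rewrite disjoint_sym => /and3P[-> _ ->].
- by [].
set s2 := foldl _ s1 Js in inv2 vP2 ext2 merge2 *.
have ext02 := extends_trans ext1 ext2; have [P2 le2 eq2] := ext02.
split=> //; last by exists (v, I).
(* The certificate of [(v, J)] puts [J] inside [T :\ r], so [J] is among the sets the merge loop ran
   over. *)
have mergeI J : [disjoint I & J] -> J != set0 -> (v, J) \in permP s2 ->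
    merge_relaxed s2 v I J.
  move=> dIJ Jn0 vJ; apply: merge2 => //.
  have [|d _ /certified_sub JT] := inv_certified inv2 (v := v) (I := J) _ Jn0.
    by rewrite inE vJ orbT.
  by rewrite (perm_mem perm_Js) mem_enum inE Jn0 subsetD JT disjoint_sym.
have [edgeR mergeR] := rel; split.
- move=> x w J; rewrite P2 in_setU1 => /orP[/eqP[-> ->] _ vwE|xP Jn0 xwE].
    apply: edge_relaxed_extends ext2 _ => //.
    by apply: edge1; rewrite (perm_mem perm_ws) mem_enum inE.
  apply: edge_relaxed_extends ext02 (edgeR _ _ _ xP Jn0 xwE).
  by rewrite in_setU1 xP orbT.
- move=> x J J' dJ Jn0 J'n0 xJ xJ'; move: (xJ) (xJ').
  rewrite P2 !in_setU1; case: eqP => [[ex eJ] _ _|_ /= xPJ].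
    by rewrite ex eJ in dJ xJ' *; apply: mergeI.
  case: eqP => [[ex eJ] _|_ /= xPJ'].
    rewrite ex eJ in dJ xJ *; rewrite /merge_relaxed setUC addeC.
    by apply: mergeI => //; rewrite disjoint_sym.
  apply: merge_relaxed_extends ext02 (mergeR _ _ _ dJ Jn0 J'n0 xPJ xPJ').
    by rewrite in_setU1 xPJ orbT.
  by rewrite in_setU1 xPJ' orbT.
Qed.

Lemma init_invariant : invariant (init_state R T r) /\ relaxed (init_state R T r).
Proof.
have inP v I : ((v, I) \in [set (u, set0) | u : V]) = (I == set0).
  apply/imsetP/eqP => [[u _ [_ ->]]|->] //; by exists v.
have inN v I : ((v, I) \in [set (t, [set t]) | t in T :\ r]) =
    (v \in T :\ r) && (I == [set v]).
  apply/imsetP/andP => [[t tT [-> ->]]|[vT /eqP->]]; last by exists v.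
  by rewrite tT eqxx.
split; last first.
  (* Initially only labels with empty set are permanent, so there is nothing to relax. *)
  split=> /= [v w I|v I J _ In0 _]; rewrite inP; last by rewrite (negPf In0).
  by move=> /eqP->; rewrite eqxx.
split=> /=.
- case=> v I; rewrite in_setU inN inP negb_or /= => /andP[/negPf-> /negPf->].
  by [].
- move=> v I; rewrite in_setU inN inP /= => /orP[/andP[vT /eqP->] sn0|/eqP->]; last first.
    by rewrite eqxx.
  by exists 0; [rewrite (negPf sn0) vT eqxx|apply: certified_terminal].
- case=> v I; rewrite inN inP => /andP[_ /eqP->] /=.
  by split=> //; apply/set0Pn; exists v; rewrite set11.
- by move=> v; rewrite inP eqxx.
- by move=> t tT; rewrite tT eqxx /=; case: ifP.
- move=> v I d; rewrite inP => /eqP->.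
  by move/derivable_neq0; rewrite eqxx.
Qed.

(** * Termination and the returned edge set *)

Lemma reachable_invariant s :
  reachable E c T r L s -> invariant s /\ relaxed s.
Proof.
elim=> [|{}s s' _ [inv rel] /(step_invariant inv rel)[]//].
exact: init_invariant.
Qed.

(** Each iteration makes one more label permanent, and there are finitely many labels. *)
Lemma no_infinite_run : ~ exists run : nat -> state R V,
  run 0%N = init_state R T r /\ forall n, step E c T r L (run n) (run n.+1).
Proof.
case=> run [run0 runS].
have reach n : reachable E c T r L (run n).
  elim: n => [|n IHn]; first by rewrite run0; constructor.
  exact: reachable_step IHn (runS n).
have cardP n : (n <= #|permP (run n)|)%N.
  elim: n => // n IHn; have [inv rel] := reachable_invariant (reach n).
  have [_ _ [x xP ->]] := step_invariant inv rel (runS n).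
  by rewrite cardsU1 xP.
by have := leq_trans (cardP #|{: label V}|.+1) (max_card _); rewrite ltnn.
Qed.

Lemma target_derivable : T :\ r != set0 ->
  exists d, derivable E c T r r (T :\ r) d.
Proof.
move=> Tn0; have spE : spans E E r (T :\ r) by split.
by have [d dd _] := spans_derivable simpleE c_gt0 spE Tn0 (subxx _); exists d.
Qed.

(** If [r] is the only terminal, the target is a label with empty set and hence permanent. *)
Lemma target_neq0 s : invariant s -> target T r \notin permP s -> T :\ r != set0.
Proof.
move=> inv; apply: contraNneq => T0; rewrite /target T0.
by have [] := inv_empty inv r.
Qed.

(** Connectivity makes the target derivable; as it is not permanent, the frontier of a derivation
    supplies an open label. *)
Lemma step_exists s : reachable E c T r L s -> target T r \notin permP s ->
  exists s', step E c T r L s s'.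
Proof.
move=> /reachable_invariant[inv rel] ntP.
have [d der] := target_derivable (target_neq0 inv ntP).
case: (frontier inv rel der) => [tP|[w [J [F [wN _ _ _]]]]].
  by rewrite /target tP in ntP.
have [[v I] vN minv] := @arg_minP _ _ _ (w, J) (mem (openN s)) (key T L s) wN.
eexists; split=> //.
exists v, I, (enum [set w | [set v; w] \in E]).
by exists (enum [set J : {set V} | (J != set0) && (J \subset (T :\ r) :\: I)]).
Qed.

Lemma target_certified s : invariant s -> target T r \in permP s ->
  T :\ r != set0 ->
  exists2 d, lval s (target T r) = d%:E
    & certified (bdata s) (permP s) r (T :\ r) d.
Proof. by move=> inv tP; apply: inv_certified => //; rewrite in_setU tP orbT. Qed.

Lemma backtracks_terminates s : reachable E c T r L s ->
  target T r \in permP s -> exists F, backtracks (bdata s) (target T r) F.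
Proof.
move=> /reachable_invariant[inv _] tP.
have [T0|Tn0] := eqVneq (T :\ r) set0; last first.
  by have [d _ /certified_backtracks] := target_certified inv tP Tn0.
have [_ bt] := inv_empty inv r; rewrite /target T0.
eexists; apply: (@backtracks_union _ _ r set0 (fun=> set0)) => [w|x].
  by rewrite bt => /setP/(_ (w, set0)); rewrite !inE eqxx.
by rewrite bt inE.
Qed.

(** The cost of [F] is at most the target's value, which is at most every derivable value, in
    particular one bounded by the cost of [G]. With [r] as only terminal, [F] is empty. *)
Lemma returned_min_spans s F G : reachable E c T r L s ->
  target T r \in permP s -> backtracks (bdata s) (target T r) F ->
  spans E F r (T :\ r) /\ (spans E G r (T :\ r) -> cost c F <= cost c G).
Proof.
move=> /reachable_invariant[inv _] tP bF.
have [T0|Tn0] := eqVneq (T :\ r) set0.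
  have [_ bt] := inv_empty inv r.
  case/backtracksP: bF; rewrite /target T0 bt /=.
    by case=> w [H [/setP/(_ (w, set0))]]; rewrite !inE eqxx.
  case=> _ [H _ ->]; rewrite big_set0; split.
    exact: spansS (sub0set _) (spans0 _ _).
  by case=> GE _ _; rewrite {1}/cost big_set0; apply: (cost_ge0 c_gt0).
have [d ld ct] := target_certified inv tP Tn0.
have [spF leF] := backtracks_spans ct bF; split=> // spG.
have [d' der' le'] := spans_derivable simpleE c_gt0 spG Tn0 (subxx _).
have := inv_optimal inv tP der'; rewrite -/(target T r) ld lee_fin => le_d.
exact: le_trans leF (le_trans le_d le').
Qed.

End Algorithm.

Theorem theorem1 (R : realType) (V : finType) (E : {set {set V}})
    (c : {set V} -> R) (T : {set V}) (r : V) (L : V -> {set V} -> R)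
    (simpleE : simple_graph E) (connE : connected_graph E)
    (c_gt0 : forall e, e \in E -> 0 < c e)
    (rT : r \in T) (validL : valid_lower_bound c E T r L) :
  dijkstra_steiner_terminates E c T r L /\
  forall F : {set {set V}}, dijkstra_steiner_returns E c T r L F ->
    exists S : subgraph V, optimum_steiner_tree c E T S /\ S.2 = F.
Proof.
split.
  split.
  - exact: (no_infinite_run c_gt0 rT validL).
  - by move=> s; apply: step_exists.
  - by move=> s; apply: (backtracks_terminates c_gt0 rT validL).
move=> F [s [reach tP bF]].
have minF G := returned_min_spans simpleE c_gt0 rT validL G reach tP bF.
rewrite -(setD1K rT).
(* The argument [set0] is a dummy: the first component does not depend on the competitor. *)
apply: (min_spans_optimum c_gt0 (proj1 (minF set0))) => G.
exact: (proj2 (minF G)).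
Qed.
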